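(* Let $\mathcal{H}$ be a complex Hilbert space. If $T\in\mathcal{B}(\mathcal{H})$ is half-centered and $\overline{T\mathcal{H}}=\mathcal{H}$, then $T$ is centered.
   Context: A bounded operator $T$ is half-centered if the operators $T^{*k}T^{k}$, $k\geq 1$, mutually commute. It is centered if all the operators in the family $\{T^{k}T^{*k}:k\geq 1\}\cup\{T^{*k}T^{k}:k\geq 1\}$ mutually commute. *)

(* Defs.v *)
From HB Require Import structures.
From mathcomp Require Import all_boot all_order all_algebra.
From mathcomp Require Import all_classical all_reals all_analysis.
From mathcomp Require Import complex ring lra.

Set Implicit Arguments.
Unset Strict Implicit.
Unset Printing Implicit Defensive.

Import Order.TTheory GRing.Theory Num.Theory.
Import numFieldNormedType.Exports.

Local Open Scope classical_set_scope.
Local Open Scope ring_scope.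

(* The inner product is linear in its first argument and conjugate-linear in
   the second. *)
HB.mixin Record isHilbert (R : realType) H
    of CompleteNormedModule R[i] H := {
  inner : {dot H for (@Num.conj R[i])} ;
  normr_inner : forall x : H, `|x| ^+ 2 = inner x x
}.

#[short(type="hilbertType")]
HB.structure Definition Hilbert (R : realType) :=
  {H of isHilbert R H & CompleteNormedModule R[i] H}.

(* The value at x is the vector z such that inner (T y) x = inner y z for all
   y; it exists and is unique when T is bounded (adjointP, adjoint_uniq), and
   the default value 0 is then never used. *)
Definition adjoint (R : realType) (H : hilbertType R) (T : H -> H) (x : H) : H :=
  xget 0 [set z | forall y, inner (T y) x = inner y z].

Definition commuting_family (X : Type) (F : set (X -> X)) : Prop :=
  forall A B, F A -> F B -> A \o B = B \o A.

Section CenteredOperators.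
Context {R : realType} {H : hilbertType R}.
Implicit Types T : H -> H.

Definition adjpow_pow_family T : set (H -> H) :=
  [set A | exists2 k, (1 <= k)%N & A = iter k (adjoint T) \o iter k T].

Definition pow_adjpow_family T : set (H -> H) :=
  [set A | exists2 k, (1 <= k)%N & A = iter k T \o iter k (adjoint T)].

Definition half_centered T : Prop := commuting_family (adjpow_pow_family T).

Definition centered T : Prop :=
  commuting_family (pow_adjpow_family T `|` adjpow_pow_family T).

End CenteredOperators.

Section Riesz.
Context {R : realType} {H : hilbertType R}.
Local Notation C := R[i].
Local Notation "''[' u , v ]" := (inner u v) : ring_scope.
Implicit Types (u v w x y z : H) (s : C).

Lemma innerDl x y z : '[x + y, z] = '[x, z] + '[y, z].
Proof. exact: linearDl. Qed.

Lemma innerZl s x z : '[s *: x, z] = s * '[x, z].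
Proof. exact: linearZl_LR. Qed.

Lemma inner_conj x y : '[x, y] = '[y, x]^*%R.
Proof. by have := @hermitian_subproof _ _ _ _ inner x y; rewrite expr0 mul1r. Qed.

Lemma innerDr x y z : '[z, x + y] = '[z, x] + '[z, y].
Proof. exact: linearD. Qed.

Lemma innerZr s x z : '[z, s *: x] = s^*%R * '[z, x].
Proof. exact: linearZr_LR. Qed.

Lemma inner0r x : '[x, 0] = 0.
Proof. exact: linear0. Qed.

(* Riesz representation is obtained by minimising this quadratic functional. *)
Definition riesz_quad (f : H -> C) y : C := `|y| ^+ 2 - (f y + (f y)^*%R).

Section Functional.
Variable f : H -> C.
Hypothesis flin : forall s x y, f (s *: x + y) = s * f x + f y.

Local Notation J := (riesz_quad f).

Let functional_scaleD s x y : f (y + s *: x) = f y + s * f x.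
Proof. by rewrite addrC flin addrC. Qed.

Lemma riesz_quad_real y : J y \is Num.real.
Proof.
by rewrite /riesz_quad rpredB ?rpredX ?normr_real// CrealE rmorphD/= conjCK addrC.
Qed.

Lemma riesz_quadD y v s :
  J (y + s *: v) = J y - (s * (f v - '[v, y]) + (s * (f v - '[v, y]))^*%R)
                   + s * s^*%R * `|v| ^+ 2.
Proof.
rewrite /riesz_quad !normr_inner functional_scaleD !(innerDl, innerDr, innerZl, innerZr).
rewrite (inner_conj y v) !(rmorphD, rmorphM, rmorphB)/=.
ring.
Qed.

Lemma functional_gap mu y v : (forall w, mu <= J w) ->
  `|f v - '[v, y]| ^+ 2 <= (J y - mu) * `|v| ^+ 2.
Proof.
move=> mu_le; have [->|v0] := eqVneq v 0.
  have f0 : f 0 = 0.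
    by apply: (addrI (f 0)); rewrite -[X in X + _]mul1r -flin scaler0 !addr0.
  by rewrite f0 inner_conj inner0r conjC0 subr0 !normr0 expr0n/= mulr0.
set g := f v - _; have vn : `|v| ^+ 2 != 0 by rewrite sqrf_eq0 normr_eq0.
have vc : (`|v| ^+ 2)^*%R = `|v| ^+ 2 :> C.
  by rewrite (CrealP _)// rpredX// normr_real.
have := mu_le (y + (g^*%R / `|v| ^+ 2) *: v); rewrite riesz_quadD -/g.
have : 0 < `|v| ^+ 2 by rewrite exprn_gt0// normr_gt0.
rewrite normCK; move: (`|v| ^+ 2) vn vc => N N0 Nc Ngt0.
rewrite !(rmorphM, fmorphV)/= conjCK Nc => h.
rewrite -ler_pdivrMr// -subr_ge0; move: h; rewrite -subr_ge0.
by congr (0 <= _); field.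
Qed.

Lemma riesz_quad_parallelogram x y :
  `|x - y| ^+ 2 = 2 * J x + 2 * J y - 4 * J (2^-1 *: (x + y)).
Proof.
have -> : 2^-1 *: (x + y) = 0 + 2^-1 *: (x + 1 *: y) by rewrite add0r scale1r.
rewrite -[x - y](_ : x + (-1) *: y = _); last by rewrite scaleN1r.
have f0 : f 0 = 0.
  by apply: (addrI (f 0)); rewrite -[X in X + _]mul1r -flin scaler0 !addr0.
rewrite /riesz_quad !functional_scaleD f0 add0r.
rewrite add0r !normr_inner !(innerDl, innerDr, innerZl, innerZr).
rewrite !(rmorphD, rmorphM, fmorphV, rmorphN, rmorph_nat, rmorph1)/=.
by field.
Qed.

End Functional.

Lemma inner_bound x y : `|'[x, y]| <= `|x| * `|y|.
Proof.
rewrite -(@ler_pXn2r _ 2)// ?nnegrE ?mulr_ge0// exprMn mulrC.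
have flin s u w : '[s *: u + w, y] = s * '[u, y] + '[w, y].
  by rewrite innerDl innerZl.
have i0 : '[0, y] = 0 by rewrite inner_conj inner0r conjC0.
have := @functional_gap (fun w => '[w, y]) flin (- `|y| ^+ 2) 0 x.
rewrite /riesz_quad/= inner0r subr0 normr0 expr0n/= i0 conjC0 addr0 subr0.
rewrite opprK add0r; apply => w.
rewrite -subr_ge0 -[X in 0 <= X](_ : `|w - y| ^+ 2 = _) ?exprn_ge0//.
rewrite -[w - y](_ : w + (-1) *: y = _); last by rewrite scaleN1r.
rewrite !normr_inner !(innerDl, innerDr, innerZl, innerZr) (inner_conj y w).
by rewrite !(rmorphN, rmorph1)/=; ring.
Qed.

Section Representation.
Variable f : H -> C.
Hypothesis flin : forall s x y, f (s *: x + y) = s * f x + f y.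
Local Notation J := (riesz_quad f).
Hypothesis fbnd : exists2 M : C, 0 <= M & forall y, `|f y| <= M * `|y|.

Lemma riesz : exists z, forall y, f y = '[y, z].
Proof.
case: fbnd => M M0 fM.
have Jlb y : - M ^+ 2 <= J y.
  have re : f y + (f y)^*%R <= 2 * (M * `|y|).
    rewrite (le_trans (real_ler_norm _))//.
      by rewrite CrealE rmorphD/= conjCK addrC.
    rewrite (le_trans (ler_normD _ _))// norm_conjC mulr_natl mulr2n.
    by rewrite lerD// fM.
  rewrite /riesz_quad lerBrDr -lerBrDl opprK (le_trans re)// -subr_ge0.
  rewrite (_ : _ - _ = (M - `|y|) ^+ 2); last by ring.
  by rewrite real_exprn_even_ge0// rpredB// ger0_real.
have JE y : J y = (complex.Re (J y))%:C%C by rewrite RRe_real// riesz_quad_real.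
pose m : R := inf (range (fun y => complex.Re (J y))).
have minf : has_inf (range (fun y => complex.Re (J y))).
  split; first by exists (complex.Re (J 0)), 0.
  exists (complex.Re (- M ^+ 2)) => _ [y _ <-].
  by rewrite -lecR !RRe_real ?riesz_quad_real// rpredN rpredX// ger0_real.
have mu_le y : m%:C%C <= J y.
  by rewrite JE lecR; apply: ge_inf; [exact: minf.2|exists y].
have /choice[u uP] (n : nat) : exists y, J y - m%:C%C < n.+1%:R^-1.
  have [|_ [y _ <-] hy] := @inf_adherent _ _ (n.+1%:R^-1) _ minf.
    by rewrite invr_gt0 ltr0n.
  exists y; rewrite ltrBlDl JE.
  by rewrite -(rmorph_nat (real_complex R)) -fmorphV -rmorphD ltcR.
have small (e : C) : 0 < e -> \forall n \near \oo, n.+1%:R^-1 < e.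
  move=> e0; have eE : e = (complex.Re e)%:C%C by rewrite RRe_real// gtr0_real.
  have r0 : 0 < complex.Re e by rewrite -ltcR -eE.
  near=> n; rewrite eE -(rmorph_nat (real_complex R)) -fmorphV ltcR.
  by near: n; exact: near_infty_natSinv_lt (PosNum r0).
have /cauchy_cvgP/cvg_ex[z uz] : cauchy (u @ \oo).
  apply/cauchy_ballP => e e0.
  have e4 : 0 < e ^+ 2 / 4 by rewrite divr_gt0// exprn_gt0.
  have uJn : \forall n \near \oo, 2 * J (u n) < 2 * (m%:C%C + e ^+ 2 / 4).
    near=> n; rewrite ltr_pM2l// -ltrBlDl (lt_trans (uP n))//.
    by near: n; exact: small.
  have uJ : \forall x \near u @ \oo, 2 * J x < 2 * (m%:C%C + e ^+ 2 / 4).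
    exact: uJn.
  near=> ab; rewrite -ball_normE/= -(@ltr_pXn2r _ 2)// ?nnegrE ?normr_ge0 ?(ltW e0)//.
  rewrite (riesz_quad_parallelogram flin) (_ : e ^+ 2 = 2 * (m%:C%C + e ^+ 2 / 4)
    + 2 * (m%:C%C + e ^+ 2 / 4) - 4 * m%:C%C); last by field.
  apply: ltr_leD; last by rewrite lerN2 ler_pM2l// mu_le.
  by apply: ltrD; near: ab; [exact: (cvg_fst uJ)|exact: (cvg_snd uJ)].
exists z => v; apply/eqP; rewrite -subr_eq0 -normr_le0.
apply/ler_addgt0Pr => e e0; rewrite add0r.
pose d := e / (2 * (`|v| + 1)).
have v1 : 0 < `|v| + 1 by rewrite ltr_wpDl.
have d0 : 0 < d by rewrite divr_gt0// mulr_gt0.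
near \oo => n.
have -> : f v - '[v, z] = (f v - '[v, u n]) + '[v, u n - z].
  by rewrite -(scaleN1r z) innerDr innerZr rmorphN rmorph1 mulN1r addrA subrK.
apply: (le_trans (ler_normD _ _)).
have dv : 0 <= d * `|v| by apply: mulr_ge0; rewrite ?(ltW d0).
have h1 : `|f v - '[v, u n]| <= d * `|v|.
  rewrite -(@ler_pXn2r _ 2)// ?nnegrE.
  rewrite (le_trans (functional_gap flin _ _ mu_le))// exprMn ler_wpM2r ?exprn_ge0//.
  rewrite ltW// (lt_trans (uP n))//.
  by near: n; apply: small; rewrite exprn_gt0.
have h2 : `|'[v, u n - z]| <= d * `|v|.
  rewrite (le_trans (inner_bound _ _))// mulrC ler_wpM2r// ltW// -normrN opprB.
  by near: n; move/cvgrPdist_lt: uz; exact.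
rewrite (le_trans (lerD h1 h2))// -mulrDl -mulr2n -[d *+ 2]mulr_natl /d.
rewrite (_ : 2 * _ * _ = e * (`|v| / (`|v| + 1))); last by field; rewrite gt_eqF.
by rewrite ger_pMr// ler_pdivrMr// mul1r lerDl.
Unshelve. all: by end_near. Qed.


End Representation.

Lemma adjointP (T : {linear H -> H}) : bounded_near T (nbhs (0 : H)) ->
  forall x y, inner (T y) x = inner y (adjoint T x).
Proof.
move=> /linear_boundedP Tb x; rewrite /adjoint.
have [z zP] : exists z, forall y, '[T y, x] = '[y, z].
  apply: (@riesz (fun y => '[T y, x])) => [s u v|].
    by rewrite linearP innerDl innerZl.
  have [M M0 TM] := pinfty_ex_gt0 Tb.
  exists (M * `|x|); first by rewrite mulr_ge0// ltW.
  by move=> y; rewrite (le_trans (inner_bound _ _))// mulrAC ler_wpM2r.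
by case: xgetP => [w _ wP //|/(_ z)].
Qed.

Lemma adjoint_uniq (T : H -> H) x z :
  (forall y, inner (T y) x = inner y z) -> adjoint T x = z.
Proof.
move=> zP; rewrite /adjoint; case: xgetP => [w _ wP|/(_ z)//].
apply/subr0_eq/normr0_eq0/eqP; rewrite -sqrf_eq0 normr_inner.
by rewrite -{2}(scaleN1r z) innerDr innerZr rmorphN rmorph1 mulN1r -zP -wP subrr.
Qed.

End Riesz.

(* Main.v *)
Require Import Defs.
From HB Require Import structures.
From mathcomp Require Import all_boot all_order all_algebra.
From mathcomp Require Import all_classical all_reals all_analysis.
From mathcomp Require Import complex.

Set Implicit Arguments.
Unset Strict Implicit.
Unset Printing Implicit Defensive.

Import Order.TTheory GRing.Theory Num.Theory.
Import numFieldNormedType.Exports.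

Local Open Scope classical_set_scope.
Local Open Scope ring_scope.

(** Write A_k = T*^k T^k and B_k = T^k T*^k. Since T*^j A_k T^j = A_(j+k), the
hypothesis A_j A_(j+k) = A_(j+k) A_j reads
   T*^j (B_j A_k) T^j = T*^j (A_k B_j) T^j.
Density of the range of T makes T* injective, so the factor T*^j cancels on the
left; taking adjoints, the factor T^j cancels on the right for the same reason.
Hence B_j commutes with A_k ([pow_adjpow_commute]). Commutation of the B's
follows, because for j <= k, with m = k - j,
   B_j B_k = T^j (A_j B_m) T*^j = T^j (B_m A_j) T*^j = B_k B_j
([pow_adjpow_commute_le]). *)

Section AdjointPairs.
Context {R : realType} {H : hilbertType R}.
Implicit Types S T f g : H -> H.

(** Stating adjointness as a relation, rather than through the function
[adjoint], lets powers and compositions be handled without checking that they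
are bounded or linear. *)
Definition adjoint_pair S T := forall x y : H, inner (T y) x = inner y (S x).

Lemma innerBr (x y z : H) : inner z (x - y) = inner z x - inner z y.
Proof. by rewrite -(scaleN1r y) innerDr innerZr rmorphN rmorph1 mulN1r. Qed.

Lemma innerBl (x y z : H) : inner (x - y) z = inner x z - inner y z.
Proof. by rewrite -(scaleN1r y) innerDl innerZl mulN1r. Qed.

Lemma inner_injr (u v : H) : (forall y, inner y u = inner y v) -> u = v.
Proof.
move=> uv; apply/subr0_eq/normr0_eq0/eqP; rewrite -sqrf_eq0 normr_inner.
by rewrite innerBr uv subrr.
Qed.

Lemma adjoint_pair_sym S T : adjoint_pair S T -> adjoint_pair T S.
Proof. by move=> ST x y; rewrite inner_conj -ST -inner_conj. Qed.

Lemma adjoint_pair_comp S T S' T' :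
  adjoint_pair S T -> adjoint_pair S' T' -> adjoint_pair (S' \o S) (T \o T').
Proof. by move=> ST ST' x y /=; rewrite ST ST'. Qed.

Lemma adjoint_pair_iter S T k :
  adjoint_pair S T -> adjoint_pair (iter k S) (iter k T).
Proof.
move=> ST; elim: k => [//|k IHk] x y.
by rewrite iterSr IHk ST iterS.
Qed.

(** A vector orthogonal to a dense set vanishes: a point of the set closer to
it than 0 is would contradict Cauchy-Schwarz. *)
Lemma orthogonal_dense0 (D : set H) (w : H) :
  closure D = [set: H] -> (forall y, D y -> inner y w = 0) -> w = 0.
Proof.
move=> Ddense Dw; apply/eqP/negP => /negP w0.
have w_gt0 : 0 < `|w| by rewrite normr_gt0.
have : closure D w by rewrite Ddense.
move=> /(_ _ (nbhsx_ballx w _ w_gt0))[y [Dy]]; rewrite -ball_normE/= => wy.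
have := inner_bound (w - y) w.
rewrite innerBl (Dw y)// subr0 -normr_inner ger0_norm ?exprn_ge0// expr2.
by rewrite ler_pM2r// => /le_lt_trans/(_ wy); rewrite ltxx.
Qed.

Lemma dense_range_adjoint_inj S T : adjoint_pair S T ->
  closure (range T) = [set: H] -> injective S.
Proof.
move=> ST Tdense u v Suv; apply/subr0_eq/(orthogonal_dense0 Tdense) => _ [y _ <-].
by rewrite innerBr !ST Suv subrr.
Qed.

(** The left factor cancels by injectivity. The right one does after passing to
adjoints, which turn it into the same injective factor on the left and exchange
[f] with [g]. *)
Lemma sandwich_adjoint_cancel S T f g : adjoint_pair S T -> injective S ->
  adjoint_pair g f -> S \o f \o T = S \o g \o T -> f = g.
Proof.
move=> ST Sinj gf SfT; apply/funext => x; apply: (Sinj); apply: inner_injr => y.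
have fT : f (T y) = g (T y) by apply: Sinj; exact: (congr1 (@^~ y) SfT).
by rewrite -!ST -gf fT (adjoint_pair_sym gf).
Qed.

End AdjointPairs.

Section HalfCentered.
Context {R : realType} {H : hilbertType R}.
Variables S T : H -> H.
Hypothesis ST : adjoint_pair S T.
Hypothesis S_inj : injective S.

Let A k := iter k S \o iter k T.
Let B k := iter k T \o iter k S.

Hypothesis A_commute : forall j k, A j \o A k = A k \o A j.

Lemma pow_adjpow_commute j k : B j \o A k = A k \o B j.
Proof.
have STj n := adjoint_pair_iter n ST.
apply: (sandwich_adjoint_cancel (STj j)).
- by elim: j => [//|j IHj] x y /S_inj/IHj.
- apply: adjoint_pair_comp; apply: adjoint_pair_comp => //;
  exact: (adjoint_pair_sym (STj _)).
have AD x : iter j S (A k (iter j T x)) = A (j + k)%N x.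
  by rewrite /A/= iterD addnC iterD.
apply/funext => x.
have := congr1 (@^~ x) (A_commute j (j + k)) => /=.
by rewrite -!AD.
Qed.

Lemma pow_adjpow_commute_le j k : (j <= k)%N -> B j \o B k = B k \o B j.
Proof.
move=> /subnKC <-; move: (k - j)%N => m; apply/funext => x.
have BD y : B (j + m) y = iter j T (B m (iter j S y)).
  by rewrite /B/= iterD addnC iterD.
have := congr1 (@^~ (iter j S x)) (pow_adjpow_commute m j).
by rewrite /= !BD => /(congr1 (iter j T)) /= ->.
Qed.

End HalfCentered.

Theorem corollary2p2 (R : realType) (H : hilbertType R) (T : {linear H -> H})
    (T_bounded : bounded_near T (nbhs (0 : H)))
    (T_half_centered : half_centered T)
    (T_dense_range : closure (range T) = [set: H]) :
  centered T.
Proof.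
have ST : adjoint_pair (adjoint T) T := adjointP T_bounded.
have S_inj := dense_range_adjoint_inj ST T_dense_range.
pose A k := iter k (adjoint T) \o iter k T.
have A_commute j k : A j \o A k = A k \o A j.
  by case: j k => [|j] [|k] //; apply: T_half_centered; [exists j.+1|exists k.+1].
have BA := pow_adjpow_commute ST S_inj A_commute.
have BB := pow_adjpow_commute_le ST S_inj A_commute.
move=> _ _ [[j _ ->]|[j _ ->]] [[k _ ->]|[k _ ->]].
- by have [jk|/ltnW kj] := leqP j k; [exact: BB|apply/esym/BB].
- exact: BA.
- exact/esym/BA.
- exact: A_commute.
Qed.
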